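(* Let $A\in\mathbb{R}^{n\times n}$, let the vector norm be the Euclidean norm, let $j\in\{1,\dots,q\}$ be such that $\Lambda_j$ is single complex, and let $u\in\mathbb{R}^n$. The $\frac{\pi}{\omega_j}$-periodic function $t\mapsto\|\widehat\Theta_j(t,u)\|_2$ oscillates monotonically between the extreme values $$\max_{t\in\mathbb{R}}\|\widehat\Theta_j(t,u)\|_2=\sqrt{\frac{1+V_j}{2}}\quad\text{and}\quad\min_{t\in\mathbb{R}}\|\widehat\Theta_j(t,u)\|_2=\sqrt{\frac{1-V_j}{2}} .$$ The maximum value is achieved if $\Omega_j(t)+\Delta_j(u)$ is an even multiple of $\pi$ and the minimum value is achieved if $\Omega_j(t)+\Delta_j(u)$ is an odd multiple of $\pi$.
   Context: The spectrum of $A$ is partitioned by real parts into $\Lambda_1,\dots,\Lambda_q$, where $\Lambda_j$ contains all eigenvalues with real part $r_j$ and $r_1>\dots>r_q$. $\Lambda_j$ is single complex if it consists of a complex conjugate pair $\lambda_j,\overline{\lambda_j}$ of non-real eigenvalues, each having exactly one Jordan block of maximum order; $\lambda_j$ is the one with positive imaginary part $\omega_j>0$. Let $V$ be an invertible matrix whose columns form a Jordan basis for $A$ and $W=V^{-1}$. Let $v^{(j,1)},\dots,v^{(j,M_j)}$ (columns of $V$) be the unique longest Jordan chain for $\lambda_j$, with $v^{(j,1)}$ an eigenvector; put $v^{(j)}:=v^{(j,1)}$ and let $w^{(j)}$ be the row of $W$ whose index equals the column index of $v^{(j,M_j)}$ in $V$. The basis is chosen so that $\overline{v^{(j,1)}},\dots,\overline{v^{(j,M_j)}}$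 are columns of $V$ forming the longest Jordan chain for $\overline{\lambda_j}$ and the row of $W$ corresponding to $\overline{v^{(j,M_j)}}$ is $\overline{w^{(j)}}$. Put $\widehat v^{(j)}:=v^{(j)}/\|v^{(j)}\|_2$, $\widehat w^{(j)}:=w^{(j)}/\|w^{(j)}\|_2$. Polar forms: $\widehat v^{(j)}_k=|\widehat v^{(j)}_k|\mathrm{e}^{\mathrm{i}\alpha_{jk}}$; $\widehat w^{(j)}u=|\widehat w^{(j)}u|\mathrm{e}^{\mathrm{i}\gamma_j(u)}$; $(\widehat v^{(j)})^T\widehat v^{(j)}=V_j\mathrm{e}^{\mathrm{i}\delta_j}$ with $V_j\ge0$ (transpose without conjugation); the angle of $0$ is any fixed real number. $\widehat\Theta_j(t,u):=\big(|\widehat v^{(j)}_k|\cos(\omega_jt+\alpha_{jk}+\gamma_j(u))\big)_{k=1,\dots,n}\in\mathbb{R}^n$. Let $R_j\in\mathbb{R}^{2\times n}$ have rows $\mathrm{Re}(\widehat w^{(j)})$ and $\mathrm{Im}(\widehat w^{(j)})$ and let $\alpha^{(j)}\in\mathbb{R}^2$ be a unit left singular vector of $R_j$ for its largest singular value; $\theta_j$ is the angle between the real axis and $\alpha^{(j)}$ (identifying $\mathbb{R}^2$ with $\mathbb{C}$). Then $\Omega_j(t):=2(\omega_jt+\theta_j)+\delta_j$ and $\Delta_j(u):=2(\gamma_j(u)-\theta_j)$. ''Oscillates monotonically between its extreme values'' means: on each closed interval whose endpoints are two consecutive points among those listed as achieving the maximum and the minimum, the function is monotone (not necessarily strictly),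 going from the maximum value to the minimum value or vice versa. *)

(* Defs.v *)
From mathcomp Require Export all_boot all_order all_algebra.
From mathcomp Require Export classical_sets reals trigo.
From mathcomp.real_closed Require Export complex.
Export Order.TTheory GRing.Theory Num.Theory.

Set Implicit Arguments.
Unset Strict Implicit.
Unset Printing Implicit Defensive.

Global Open Scope ring_scope.

Section ComplexVectors.
Variable R : realType.

Definition modc (z : R[i]) : R := ComplexField.Normc.normc z.

Definition expi (a : R) : R[i] := Complex (cos a) (sin a).

(* Every real number is an argument of 0. *)
Definition is_arg (z : R[i]) (a : R) : Prop := z = (modc z)%:C%C * expi a.

(* Used only on rows and columns, where it is the Euclidean norm. *)
Definition norm2 m n (M : 'M[R]_(m, n)) : R :=
  Num.sqrt (\sum_i \sum_j M i j ^+ 2).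

Definition cnorm2 m n (M : 'M[R[i]]_(m, n)) : R := norm2 (map_mx modc M).

Definition normalize m n (M : 'M[R[i]]_(m, n)) : 'M[R[i]]_(m, n) :=
  ((cnorm2 M)^-1)%:C%C *: M.

Definition cmx m n (M : 'M[R]_(m, n)) : 'M[R[i]]_(m, n) :=
  map_mx (real_complex R) M.

End ComplexVectors.

Section JordanBasis.
Variable C : fieldType.

(* The blocks of a Jordan form; block i has order (blk_pred i).+1, so that the
   orders are positive by construction. *)
Record jordan_blocks := JordanBlocks {
  nblk : nat;
  blk_eig : 'I_nblk -> C;
  blk_pred : 'I_nblk -> nat }.

Definition blk_order (S : jordan_blocks) (i : 'I_(nblk S)) : nat :=
  (blk_pred i).+1.

Definition jordan_dim (S : jordan_blocks) : nat := \sum_i @blk_order S i.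

Definition jordan_block (a : C) m : 'M[C]_m :=
  \matrix_(i, k) (if i == k then a else (i.+1 == k :> nat)%:R).

Definition jordan_mx (S : jordan_blocks) : 'M[C]_(jordan_dim S) :=
  \mxdiag_i jordan_block (blk_eig i) (blk_order i).

(* The columns of V form a Jordan basis for A and W is the inverse of V. The
   columns of V are indexed by the positions in the blocks of S; the two inverse
   equations force jordan_dim S = n. *)
Definition jordan_basis n (A : 'M[C]_n) (S : jordan_blocks)
    (V : 'M[C]_(n, jordan_dim S)) (W : 'M[C]_(jordan_dim S, n)) : Prop :=
  [/\ V *m W = 1%:M, W *m V = 1%:M & A *m V = V *m jordan_mx S].

(* Column k of the result is the (k+1)-th vector of the Jordan chain of block b
   (k = 0: the eigenvector). *)
Definition chain n (S : jordan_blocks) (V : 'M[C]_(n, jordan_dim S))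
    (b : 'I_(nblk S)) : 'M[C]_(n, (blk_pred b).+1) :=
  submxrow (q_ := @blk_order S) V b.

(* The rows of the inverse matrix with the same indices as the columns of the
   chain of block b. *)
Definition cochain n (S : jordan_blocks) (W : 'M[C]_(jordan_dim S, n))
    (b : 'I_(nblk S)) : 'M[C]_((blk_pred b).+1, n) :=
  submxcol (p_ := @blk_order S) W b.

Definition unique_longest (S : jordan_blocks) (a : C) (b : 'I_(nblk S)) : Prop :=
  blk_eig b = a /\
  forall i, i != b -> blk_eig i = a -> (blk_order i < blk_order b)%N.

Definition one_max_block n (A : 'M[C]_n) (a : C) : Prop :=
  exists S V W, @jordan_basis n A S V W /\ exists b, @unique_longest S a b.

End JordanBasis.

Section Spectrum.
Variables (R : realType) (n : nat) (A : 'M[R]_n).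

(* r lists, in strictly decreasing order, the real parts of the eigenvalues. *)
Definition spectral_abscissae q (r : 'I_q -> R) : Prop :=
  (forall j k : 'I_q, (j < k)%N -> r k < r j) /\
  (forall x, (exists j, r j = x) <->
             (exists2 z, eigenvalue (cmx A) z & complex.Re z = x)).

Definition Lambda q (r : 'I_q -> R) (j : 'I_q) : set R[i] :=
  [set z | eigenvalue (cmx A) z /\ complex.Re z = r j]%classic.

Definition single_complex (L : set R[i]) : Prop :=
  exists z : R[i], [/\ complex.Im z != 0, L = [set z; z^*%C]%classic,
    one_max_block (cmx A) z & one_max_block (cmx A) z^*%C].

End Spectrum.

Section SingularVectors.
Variable R : realType.

Definition singular_triple m n (M : 'M[R]_(m, n)) (s : R)
    (a : 'cV[R]_m) (b : 'cV[R]_n) : Prop :=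
  [/\ 0 <= s, norm2 a = 1, norm2 b = 1, M *m b = s *: a & M^T *m a = s *: b].

Definition top_left_singular m n (M : 'M[R]_(m, n)) (a : 'cV[R]_m) : Prop :=
  exists s b, singular_triple M s a b /\
    forall s' a' b', singular_triple M s' a' b' -> s' <= s.

Definition ReIm_mx n (w : 'rV[R[i]]_n) : 'M[R]_(2, n) :=
  col_mx (map_mx (@complex.Re R) w) (map_mx (@complex.Im R) w).

End SingularVectors.

Section Oscillation.
Variable R : realType.

Definition is_maximum (f : R -> R) (M : R) : Prop :=
  (exists t, f t = M) /\ forall t, f t <= M.

Definition is_minimum (f : R -> R) (m : R) : Prop :=
  (exists t, f t = m) /\ forall t, m <= f t.

Definition even_multiple_pi (x : R) : Prop := exists k : int, x = (2 * k)%:~R * pi.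

Definition odd_multiple_pi (x : R) : Prop :=
  exists k : int, x = (2 * k + 1)%:~R * pi.

(* P is the set of listed points where the maximum M or the minimum m of f is
   achieved. *)
Definition oscillates_monotonically (f : R -> R) (P : set R) (M m : R) : Prop :=
  forall a b, a < b -> P a -> P b -> (forall t, a < t < b -> ~ P t) ->
    [/\ f a = M, f b = m & {in `[a, b] &, {homo f : x y / x <= y >-> y <= x}}] \/
    [/\ f a = m, f b = M & {in `[a, b] &, {homo f : x y / x <= y}}].

(* g stands for the angle gamma_j(u), the only dependence on u. *)
Definition Theta_hat n (v : 'cV[R[i]]_n) (alpha : 'I_n -> R) (omega g t : R) :
    'cV[R]_n :=
  \col_k (modc (v k 0) * cos (omega * t + alpha k + g)).

Definition Omega (omega theta delta t : R) : R :=
  2 * (omega * t + theta) + delta.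

Definition Delta (theta g : R) : R := 2 * (g - theta).

End Oscillation.

(* Main.v *)
(* Since |v_k|^2 cos^2(x + alpha_k) = (|v_k|^2 + Re (v_k^2 e^(2 i x))) / 2, summing
   over k for a unit vector v gives
   ||Theta_hat||^2 = (1 + Re (v^T v e^(2 i x))) / 2 with x = omega t + gamma, that
   is (1 + V_j cos (Omega_j + Delta_j)) / 2, because theta cancels in
   Omega_j + Delta_j.  Everything else is read off the cosine. *)
Require Import Defs.
From mathcomp Require Import ring lra zify.

Set Implicit Arguments.
Unset Strict Implicit.
Unset Printing Implicit Defensive.

(** * Cosine under shifts by integer multiples of pi *)

Section Trigonometry.
Variable R : realType.
Implicit Types (p x y V c omega : R).

Lemma expiD x y : expi (x + y) = expi x * expi y.
Proof. by rewrite /expi cosD sinD; simpc; rewrite [sin x * _ + _]addrC. Qed.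

Lemma cosDzpi (k : int) x :
  cos (x + k%:~R * pi) = (-1) ^+ `|k|%N * cos x.
Proof.
rewrite mulrzl; case: k => k; first by rewrite -pmulrn (alternatingn (@cosDpi R)).
(* For a negative multiple the positive case is applied from the shifted point back to [x]; the two
   equal signs then multiply to 1. *)
rewrite -{2}[x](subrK (pi *+ k.+1)) (alternatingn (@cosDpi R)) mulrA -exprMn.
by rewrite mulrNN mulr1 expr1n mul1r.
Qed.

Lemma cosD2zpi (k : int) x : cos (x + (2 * k)%:~R * pi) = cos x.
Proof. by rewrite cosDzpi abszM exprM sqrrN !expr1n mul1r. Qed.

Lemma mulzpiDpi (k : int) : (k + 1)%:~R * pi = k%:~R * pi + pi :> R.
Proof. by rewrite intrD mulrDl mul1r. Qed.

Lemma even_multiple_piD x : even_multiple_pi x -> odd_multiple_pi (x + pi).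
Proof. by case=> k ->; exists k; rewrite mulzpiDpi. Qed.

Lemma odd_multiple_piD x : odd_multiple_pi x -> even_multiple_pi (x + pi).
Proof.
case=> k ->; exists (k + 1).
have -> : 2 * (k + 1) = 2 * k + 1 + 1 :> int by ring.
by rewrite [RHS]mulzpiDpi.
Qed.

Lemma odd_multiple_piB x : odd_multiple_pi x -> even_multiple_pi (x - pi).
Proof. by case=> k ->; exists k; rewrite mulzpiDpi addrK. Qed.

Lemma cosB_even_multiple_pi p :
  even_multiple_pi p -> forall x, cos (x - p) = cos x.
Proof. by case=> k -> x; rewrite -[LHS](cosD2zpi k) subrK. Qed.

Lemma cos_even_multiple_pi (p : R) : even_multiple_pi p -> cos p = 1.
Proof. by move=> /cosB_even_multiple_pi/(_ p); rewrite subrr cos0. Qed.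

Lemma cosB_odd_multiple_pi p :
  odd_multiple_pi p -> forall x, cos (x - p) = - cos x.
Proof.
move=> /odd_multiple_piB/cosB_even_multiple_pi cosBp x; rewrite -(cosBp x).
by rewrite opprB addrA [x + pi]addrC -addrA [pi + _]addrC cosDpi opprK.
Qed.

Lemma cos_odd_multiple_pi (p : R) : odd_multiple_pi p -> cos p = -1.
Proof.
by move=> /cosB_odd_multiple_pi/(_ p); rewrite subrr cos0 => ->; rewrite opprK.
Qed.

(** Indexes the listed phases by a single integer, so that neighbouring listed points correspond to
    successive integers. *)
Lemma multiple_piP x :
  even_multiple_pi x \/ odd_multiple_pi x <-> exists k : int, x = k%:~R * pi.
Proof.
split=> [[] [k ->] | [k ->]]; [by exists (2 * k) | by exists (2 * k + 1) |].
have [m [->|->]] : exists m : int, k = 2 * m \/ k = 2 * m + 1.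
  by exists (k %/ 2)%Z; lia.
- by left; exists m.
- by right; exists m.
Qed.

(** * Range and monotonicity of sqrt((1 + V cos x) / 2) *)

Lemma ler_cos : {in `[0, pi] &, {mono (@cos R) : x y /~ y <= x}}.
Proof. by move=> x y xI yI; rewrite !leNgt ltr_cos. Qed.

(** The closed form of the norm of [Theta_hat], with V_j for [V] and the phase for [x]. *)
Definition half_cos V x : R := Num.sqrt ((1 + V * cos x) / 2).

(** [Num.sqrt] is 0 on negative numbers, hence monotone on the whole line: comparing radicands
    suffices, whatever their sign. *)
Lemma ler_half_cos V x y :
  V * cos x <= V * cos y -> half_cos V x <= half_cos V y.
Proof. by move=> ?; apply: ler_wsqrtr; lra. Qed.

Lemma half_cos_even V x :
  even_multiple_pi x -> half_cos V x = Num.sqrt ((1 + V) / 2).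
Proof. by move=> /cos_even_multiple_pi cosx; rewrite /half_cos cosx mulr1. Qed.

Lemma half_cos_odd V x :
  odd_multiple_pi x -> half_cos V x = Num.sqrt ((1 - V) / 2).
Proof. by move=> /cos_odd_multiple_pi cosx; rewrite /half_cos cosx mulrN1. Qed.

Lemma half_cos_le V x : 0 <= V -> half_cos V x <= Num.sqrt ((1 + V) / 2).
Proof.
move=> V_ge0; apply: ler_wsqrtr.
by have := ler_wpM2l V_ge0 (cos_le1 x); lra.
Qed.

Lemma half_cos_ge V x : 0 <= V -> Num.sqrt ((1 - V) / 2) <= half_cos V x.
Proof.
move=> V_ge0; apply: ler_wsqrtr.
by have := ler_wpM2l V_ge0 (cos_geN1 x); lra.
Qed.

(** Translation by [p] preserves cos and moves the interval to [0, pi], where cos decreases. *)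
Lemma half_cos_decr V p : 0 <= V -> even_multiple_pi p ->
  {in `[p, p + pi] &, {homo half_cos V : x y / x <= y >-> y <= x}}.
Proof.
move=> V_ge0 p_even x y; rewrite !in_itv /= => /andP[? ?] /andP[? ?] ?.
apply/ler_half_cos/ler_wpM2l => //.
rewrite -(cosB_even_multiple_pi p_even x) -(cosB_even_multiple_pi p_even y).
by rewrite ler_cos ?in_itv /=; lra.
Qed.

Lemma half_cos_incr V p : 0 <= V -> odd_multiple_pi p ->
  {in `[p, p + pi] &, {homo half_cos V : x y / x <= y}}.
Proof.
move=> V_ge0 p_odd x y; rewrite !in_itv /= => /andP[? ?] /andP[? ?] ?.
(* Translation by an odd multiple of pi negates cos, so the inequality is negated first and then
   reduced to [0, pi]. *)
apply/ler_half_cos/ler_wpM2l => //; rewrite -lerN2.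
rewrite -!(cosB_odd_multiple_pi p_odd).
by rewrite ler_cos ?in_itv /=; lra.
Qed.

(** The increasing affine phase maps the listed points onto the multiples of pi. Consecutive ones
    thus bound a phase interval of length pi, on which [half_cos] is monotone; the parity at the
    left end decides the direction. *)
Lemma oscillates_half_cos V omega c (f phase : R -> R) :
  0 <= V -> 0 < omega -> (forall t, phase t = omega * t + c) ->
  (forall t, f t = half_cos V (phase t)) ->
  oscillates_monotonically f
    [set t | even_multiple_pi (phase t) \/ odd_multiple_pi (phase t)]%classic
    (Num.sqrt ((1 + V) / 2)) (Num.sqrt ((1 - V) / 2)).
Proof.
move=> V_ge0 omega_gt0 phaseE fE a b ab Pa Pb noP.
have phaseK x : phase ((x - c) / omega) = x.
  by rewrite phaseE mulrC divfK ?subrK ?gt_eqF.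
have phase_lt x y : (phase x < phase y) = (x < y).
  by rewrite !phaseE ltrD2r ltr_pM2l.
have phase_le x y : (phase x <= phase y) = (x <= y).
  by rewrite !phaseE lerD2r ler_pM2l.
have phase_b : phase b = phase a + pi.
  have [k phase_a] := (multiple_piP _).1 Pa.
  have [m phase_b] := (multiple_piP _).1 Pb.
  have km : k < m.
    by move: ab; rewrite -phase_lt phase_a phase_b ltr_pM2r ?pi_gt0 ?ltr_int.
  have [k1m|mk1|mE] := ltrgtP (k + 1) m; last first.
  - by rewrite phase_a phase_b -mE mulzpiDpi.
  - by lia.
  (* If [k + 1 < m], the point of phase (k + 1) pi is listed and lies strictly between [a] and
     [b]. *)
  case: (noP (((k + 1)%:~R * pi - c) / omega)).
    rewrite -[a < _]phase_lt -[_ < b]phase_lt phaseK; apply/andP; split.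
      by rewrite mulzpiDpi -phase_a ltrDl pi_gt0.
    by rewrite phase_b ltr_pM2r ?pi_gt0 // ltr_int.
  by apply/multiple_piP; rewrite phaseK; exists (k + 1).
have phase_in x : x \in `[a, b] -> phase x \in `[phase a, phase a + pi].
  by rewrite -phase_b !in_itv /= !phase_le.
case: Pa => Pa; [left|right]; split; rewrite ?fE.
- exact: half_cos_even.
- by rewrite phase_b; apply/half_cos_odd/even_multiple_piD.
- move=> x y /phase_in xI /phase_in yI xy; rewrite /= !fE.
   by apply: (half_cos_decr V_ge0 Pa); rewrite ?phase_le.
- exact: half_cos_odd.
- by rewrite phase_b; apply/half_cos_even/odd_multiple_piD.
- move=> x y /phase_in xI /phase_in yI xy; rewrite /= !fE.
  by apply: (half_cos_incr V_ge0 Pa); rewrite ?phase_le.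
Qed.

End Trigonometry.

(** * Euclidean norms of complex vectors and the closed form of the norm of [Theta_hat] *)

Section Norms.
Variable R : realType.

Lemma sqr_norm2_col n (x : 'cV[R]_n) : norm2 x ^+ 2 = \sum_k x k 0 ^+ 2.
Proof.
rewrite sqr_sqrtr; first by apply: eq_bigr => k _; rewrite big_ord1.
by apply: sumr_ge0 => k _; apply: sumr_ge0 => l _; exact: sqr_ge0.
Qed.

Lemma cnorm2_eq0 m n (M : 'M[R[i]]_(m, n)) : cnorm2 M = 0 -> M = 0.
Proof.
(* A zero [Num.sqrt] only says that the radicand is [<= 0]; since it is a sum of squares, it is 0,
   and so is each term. *)
move=> /eqP; rewrite sqrtr_eq0 => M_le0; apply/matrixP => k l; rewrite mxE.
have sq_ge0 i (j : 'I_n) : true -> 0 <= map_mx (@modc R) M i j ^+ 2.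
  by rewrite sqr_ge0.
have row_ge0 i : true -> 0 <= \sum_j map_mx (@modc R) M i j ^+ 2.
  by move=> _; apply: sumr_ge0 => j; exact: sq_ge0.
have /psumr_eq0P rows0 : \sum_i \sum_j map_mx (@modc R) M i j ^+ 2 = 0.
  by apply/eqP; rewrite eq_le M_le0 sumr_ge0.
have /psumr_eq0P/(_ l isT)/eqP := rows0 row_ge0 k isT.
by rewrite sqrf_eq0 mxE => /(_ (sq_ge0 k))/eqP/ComplexField.Normc.eq0_normc.
Qed.

Lemma modcM (x y : R[i]) : modc (x * y) = modc x * modc y.
Proof. exact: ComplexField.Normc.normcM. Qed.

Lemma modc_real (x : R) : modc x%:C%C = `|x|.
Proof. by rewrite /modc /= expr0n addr0 sqrtr_sqr. Qed.

Lemma sqr_cnorm2_col n (v : 'cV[R[i]]_n) :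
  cnorm2 v ^+ 2 = \sum_k modc (v k 0) ^+ 2.
Proof. by rewrite sqr_norm2_col; apply: eq_bigr => k _; rewrite mxE. Qed.

Lemma sum_sqr_modc_normalize n (v : 'cV[R[i]]_n) :
  v != 0 -> \sum_k modc (normalize v k 0) ^+ 2 = 1.
Proof.
move=> v_neq0; have norm_neq0 : cnorm2 v != 0.
  by apply: contra v_neq0 => /eqP/cnorm2_eq0 ->.
have normalizeE k : modc (normalize v k 0) ^+ 2
                    = (cnorm2 v)^-1 ^+ 2 * modc (v k 0) ^+ 2.
  by rewrite mxE modcM modc_real exprMn real_normK ?num_real.
rewrite (eq_bigr _ (fun k _ => normalizeE k)).
by rewrite -mulr_sumr -sqr_cnorm2_col exprVn mulVf ?expf_neq0.
Qed.

(** A zero column [k] of [V] would make the diagonal entry [k] of [W *m V] equal to 0 instead of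
    1. *)
Lemma col_neq0 (F : fieldType) m n (V : 'M[F]_(n, m)) (W : 'M_(m, n)) k :
  W *m V = 1%:M -> col k V != 0.
Proof.
move=> WV; apply/eqP => colV0; move: WV => /matrixP/(_ k k)/eqP.
rewrite !mxE eqxx big1 1?eq_sym ?oner_eq0 // => i _.
by have /matrixP/(_ i 0) := colV0; rewrite !mxE => ->; rewrite mulr0.
Qed.

Lemma norm2_Theta_hat n (v : 'cV[R[i]]_n) (alpha : 'I_n -> R)
    (Vj delta omega g t : R) :
  \sum_k modc (v k 0) ^+ 2 = 1 ->
  (forall k, is_arg (v k 0) (alpha k)) ->
  (v^T *m v) 0 0 = Vj%:C%C * expi delta ->
  norm2 (Theta_hat v alpha omega g t) = half_cos Vj (2 * (omega * t + g) + delta).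
Proof.
move=> norm_v arg_v vTv.
(* The transpose is not conjugated, so the arguments in v_k v_k add up instead of cancelling. *)
have sumE : \sum_k (modc (v k 0) ^+ 2)%:C%C * expi (alpha k + alpha k)
            = Vj%:C%C * expi delta.
  rewrite -vTv mxE; apply: eq_bigr => k _; rewrite mxE {2 3}(arg_v k).
  by rewrite expiD rmorphXn /=; ring.
have normE : norm2 (Theta_hat v alpha omega g t) ^+ 2
             = (1 + Vj * cos (2 * (omega * t + g) + delta)) / 2.
  rewrite sqr_norm2_col.
  pose z := expi (2 * (omega * t + g)).
  have -> : Vj * cos (2 * (omega * t + g) + delta)
            = complex.Re (Vj%:C%C * expi delta * z).
    rewrite -mulrA -expiD /= mul0r subr0; congr (_ * cos _); ring.
  (* Writing the summand 1 as the sum of the |v_k|^2 makes the identity termwise; each term is the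
     double-angle formula for cos. *)
  rewrite -sumE mulr_suml raddf_sum -[X in X + _]norm_v -big_split mulr_suml.
  apply: eq_bigr => k _; rewrite mxE exprMn -(mulrA _%:C%C) -expiD /= mul0r subr0.
  have -> : alpha k + alpha k + 2 * (omega * t + g)
            = (omega * t + alpha k + g) *+ 2 by ring.
  by rewrite cos_mulr2n; field.
by rewrite /half_cos -normE sqrtr_sqr ger0_norm ?sqrtr_ge0.
Qed.

End Norms.

(** * Period, extreme values and oscillation, read off an affine phase *)

Theorem theorem13 (R : realType) (n : nat) (A : 'M[R]_n)
  (q : nat) (r : 'I_q -> R) (hr : spectral_abscissae A r)
  (j : 'I_q) (hj : single_complex A (Lambda A r j))
  (lambda : R[i]) (hlambda : Lambda A r j lambda)
  (omega : R) (homega : omega = complex.Im lambda) (omega_gt0 : 0 < omega)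
  (* Jordan basis, longest chains for lambda and its conjugate *)
  (B : jordan_blocks R[i])
  (V : 'M[R[i]]_(n, jordan_dim B)) (W : 'M[R[i]]_(jordan_dim B, n))
  (hVW : jordan_basis (cmx A) V W)
  (b b' : 'I_(nblk B))
  (hb : unique_longest lambda b) (hb' : unique_longest lambda^*%C b')
  (hlength : blk_order b' = blk_order b)
  (hchain : forall (k : 'I_(blk_pred b).+1) (k' : 'I_(blk_pred b').+1),
     k = k' :> nat ->
     col k' (chain V b') = map_mx (@conjc R) (col k (chain V b)))
  (hcochain : row ord_max (cochain W b')
              = map_mx (@conjc R) (row ord_max (cochain W b)))
  (vhat : 'cV[R[i]]_n) (hvhat : vhat = normalize (col ord0 (chain V b)))
  (what : 'rV[R[i]]_n) (hwhat : what = normalize (row ord_max (cochain W b)))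
  (* polar forms *)
  (alpha : 'I_n -> R) (halpha : forall k, is_arg (vhat k 0) (alpha k))
  (gamma : 'cV[R]_n -> R)
  (hgamma : forall x : 'cV[R]_n, is_arg ((what *m cmx x) 0 0) (gamma x))
  (Vj delta : R) (Vj_ge0 : 0 <= Vj)
  (hdelta : (vhat^T *m vhat) 0 0 = Vj%:C%C * expi delta)
  (a : 'cV[R]_2) (ha : top_left_singular (ReIm_mx what) a)
  (theta : R) (htheta : is_arg (Complex (a 0 0) (a 1 0)) theta)
  (u : 'cV[R]_n) :
  let f := fun t : R => norm2 (Theta_hat vhat alpha omega (gamma u) t) in
  let phase := fun t : R => Omega omega theta delta t + Delta theta (gamma u) in
  let fmax := Num.sqrt ((1 + Vj) / 2) in
  let fmin := Num.sqrt ((1 - Vj) / 2) in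
  (forall t, f (t + pi / omega) = f t) /\
  is_maximum f fmax /\
  is_minimum f fmin /\
  (forall t, even_multiple_pi (phase t) -> f t = fmax) /\
  (forall t, odd_multiple_pi (phase t) -> f t = fmin) /\
  oscillates_monotonically f
    [set t | even_multiple_pi (phase t) \/ odd_multiple_pi (phase t)]%classic
    fmax fmin.
Proof.
move=> f phase fmax fmin.
have vhat_norm : \sum_k modc (vhat k 0) ^+ 2 = 1.
  rewrite hvhat; apply: sum_sqr_modc_normalize.
  (* The eigenvector is a column of the invertible matrix [V], hence nonzero, so normalizing it
     gives norm 1. *)
  have -> : col ord0 (chain V b) = col (tagnat.Rank b ord0) V.
    by apply/matrixP => k l; rewrite !mxE.
  by case: hVW => _ WV _; exact: col_neq0 WV.
pose c := 2 * gamma u + delta.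
(* [theta] cancels here, leaving an affine function of slope [2 * omega]. *)
have phaseE t : phase t = 2 * omega * t + c by rewrite /phase /Omega /Delta /c; ring.
have fE t : f t = half_cos Vj (phase t).
  rewrite /f (norm2_Theta_hat _ _ _ vhat_norm halpha hdelta) phaseE /c.
  by congr half_cos; ring.
have omega2_gt0 : 0 < 2 * omega by rewrite mulr_gt0.
have phaseK x : phase ((x - c) / (2 * omega)) = x.
  by rewrite phaseE mulrC divfK ?subrK ?gt_eqF.
have fmaxE t : even_multiple_pi (phase t) -> f t = fmax.
  by rewrite fE; exact: half_cos_even.
have fminE t : odd_multiple_pi (phase t) -> f t = fmin.
  by rewrite fE; exact: half_cos_odd.
split; first move=> t.
  (* The phase gains 2 pi, written as two steps of pi whose sign changes cancel. *)
  rewrite !fE; have -> : phase (t + pi / omega) = phase t + pi + pi.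
    by rewrite !phaseE; field; rewrite gt_eqF.
  by rewrite /half_cos !cosDpi opprK.
split.
  split; last by move=> t; rewrite fE half_cos_le.
  (* The time of phase 0, an even multiple of pi. *)
  exists ((0 - c) / (2 * omega)).
  by apply: fmaxE; rewrite phaseK; exists 0; rewrite mulr0 mul0r.
split.
  split; last by move=> t; rewrite fE half_cos_ge.
  (* The time of phase pi, an odd multiple. *)
  exists ((pi - c) / (2 * omega)).
  by apply: fminE; rewrite phaseK; exists 0; rewrite mulr0 add0r mul1r.
by do 2!split=> //; exact: oscillates_half_cos omega2_gt0 phaseE fE.
Qed.
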